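(* For each $i\in\omega$ let $\lambda_i\geqslant 1$ be a cardinal, let $S_i$ be a sequentially compact Hausdorff semitopological monoid with zero, and let $B^0_{\lambda_i}(S_i)$ be a Hausdorff countably compact topological Brandt $\lambda_i^0$-extension of $S_i$. Then the direct product $\prod\{B^0_{\lambda_i}(S_i)\colon i\in\omega\}$ with the Tychonoff topology is a Hausdorff sequentially compact semitopological semigroup.
   Context: All topological spaces are Hausdorff. A semitopological semigroup is a Hausdorff topological space with a separately continuous associative operation; a semitopological monoid is a semitopological semigroup with identity. Direct products of semigroups carry the coordinatewise operation. Brandt $\lambda^0$-extension: for a monoid $S$ with zero $0_S$ and a cardinal $\lambda\geqslant 1$, $B^0_\lambda(S)$ is the set $\{(\alpha,s,\beta)\colon \alpha,\beta\in\lambda,\ s\in S\setminus\{0_S\}\}\sqcup\{0\}$ with the operation in which $0$ is the zero and $(\alpha,a,\beta)\cdot(\gamma,b,\delta)$ equals $(\alpha,ab,\delta)$ if $\beta=\gamma$ and $ab\neq 0_S$, and equals $0$ otherwise. For $\alpha,\beta\in\lambda$ put $S_{\alpha,\beta}=\{(\alpha,s,\beta)\colon s\in S\setminus\{0_S\}\}\cup\{0\}$. Topological Brandt $\lambda^0$-extension: for a semitopological monoid $(S,\tau)$ with zero, it is $B^0_\lambda(S)$ with a Hausdorff topology $\tau_B$ such that $(B^0_\lambda(S),\tau_B)$ is a semitopological semigroup and, for some $\alpha\in\lambda$, the map $0_S\mapsto 0$, $s\mapsto(\alpha,s,\alpha)$ ($s\neq 0_S$) is a homeomorphism of $(S,\tau)$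 onto the subspace $S_{\alpha,\alpha}$. A space is sequentially compact if each sequence in it has a convergent subsequence, and countably compact if each countable open cover has a finite subcover. *)

(* Defs.v *)
From mathcomp Require Import all_boot all_order all_classical topology.

Set Implicit Arguments.
Unset Strict Implicit.
Unset Printing Implicit Defensive.

Local Open Scope classical_set_scope.

Definition sequentially_compact (X : topologicalType) : Prop :=
  forall u : nat -> X, exists s : nat -> nat,
    {homo s : m n / (m < n)%N} /\ exists l : X, u \o s @ \oo --> l.

Definition countably_compact (X : topologicalType) : Prop :=
  forall F : set (set X), countable F -> F `<=` open ->
    \bigcup_(U in F) U = [set: X] ->
  exists G : set (set X),
    [/\ G `<=` F, finite_set G & \bigcup_(U in G) U = [set: X]].

(* The subspace A carries the trace topology: its open sets are A `&` V. *)
Definition homeomorphism_onto (X Y : topologicalType) (f : X -> Y)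
    (A : set Y) : Prop :=
  [/\ set_bij [set: X] A f, continuous f
    & forall U : set X, open U -> exists2 V : set Y, open V & f @` U = A `&` V].

Definition separately_continuous (X : topologicalType) (op : X -> X -> X) :
    Prop :=
  (forall a, continuous (fun x => op a x)) /\
  (forall b, continuous (fun x => op x b)).

Definition semitopological_semigroup (X : topologicalType)
    (op : X -> X -> X) : Prop :=
  [/\ hausdorff_space X, associative op & separately_continuous op].

Definition semitopological_monoid (X : topologicalType)
    (op : X -> X -> X) (e : X) : Prop :=
  [/\ semitopological_semigroup op, left_id e op & right_id e op].

Definition is_zero (X : Type) (op : X -> X -> X) (z : X) : Prop :=
  left_zero z op /\ right_zero z op.

(* [None] is the zero of the extension; the cardinal lambda is represented by
   an index type [L]. *)
Definition brandt0 (L S : eqType) (z : S) : Type :=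
  option (L * {s : S | s != z} * L).

Section Brandt0.
Variables (L S : eqType) (mul : S -> S -> S) (z : S).

(* (a, s, b) when s != z, and the zero of the extension when s = z *)
Definition brandt0_elt (a : L) (s : S) (b : L) : brandt0 L z :=
  omap (fun s' : {s : S | s != z} => (a, s', b)) (insub s).

Definition brandt0_mul (x y : brandt0 L z) : brandt0 L z :=
  match x, y with
  | Some (a, s, b), Some (c, t, d) =>
      if b == c then brandt0_elt a (mul (val s) (val t)) d else None
  | _, _ => None
  end.

Definition brandt0_block (a b : L) : set (brandt0 L z) :=
  [set brandt0_elt a s b | s in [set s | s != z]] `|` [set None].

End Brandt0.

Arguments brandt0 L {S} z.
Arguments brandt0_elt {L S} z a s b.
Arguments brandt0_mul {L S} mul z x y.
Arguments brandt0_block {L S} z a b.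

Definition brandt0_space (L S : eqType) (z : S)
  (t : Topological (brandt0 L z)) : topologicalType := Topological.Pack t.

Definition topological_brandt0_extension (L : eqType) (S : topologicalType)
    (mul : S -> S -> S) (z : S) (t : Topological (brandt0 L z)) : Prop :=
  @semitopological_semigroup (brandt0_space t) (brandt0_mul mul z) /\
  exists a : L,
    @homeomorphism_onto S (brandt0_space t)
      (fun s => brandt0_elt z a s a) (brandt0_block z a a).

Definition prod_mul (I : Type) (X : I -> Type) (op : forall i, X i -> X i -> X i)
    (x y : forall i, X i) : forall i, X i := fun i => op i (x i) (y i).

(* Main.v *)
Require Import Defs.
From mathcomp Require Import all_boot all_order all_classical topology.

Local Open Scope classical_set_scope.

(** A product of countably many sequentially compact spaces is sequentially
    compact by a diagonal argument, and the algebra of the product is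
    coordinatewise, so everything reduces to one extension [B] of [S]
    ([brandt0_sequentially_compact]).  Let [x] be a sequence in [B].

    Either some set [{(a, s, b) : s}] contains [x n] for infinitely many [n].
    The given copy of [S] in [B] is carried onto the block of [(a, b)] by
    multiplying on the left and on the right by [(a, 1, c)] and [(c, 1, b)],
    which is continuous ([brandt0_elt_continuous]); hence a convergent
    subsequence in [S] gives one in [B].

    Or every such set contains only finitely many terms, and then [x] itself
    tends to the zero ([brandt0_cvg_zero]).  Indeed these sets are open
    ([brandt0_open_block]), so no nonzero point is a cluster point of [x]; in a
    countably compact space a sequence that stayed infinitely often outside a
    neighbourhood of the zero would have a cluster point there. *)

(** * Subsequences and sequential compactness of products *)

Lemma strictly_increasing_ge_id (s : nat -> nat) :
  {homo s : m n / (m < n)%N} -> forall n, (n <= s n)%N.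
Proof.
move=> s_incr; elim=> // n IHn.
exact: leq_ltn_trans IHn (s_incr _ _ (ltnSn n)).
Qed.

Lemma subsequence_infinitely_often (P : nat -> Prop) :
  (forall N, exists n, (N <= n)%N /\ P n) ->
  exists s : nat -> nat, {homo s : m n / (m < n)%N} /\ forall k, P (s k).
Proof.
move=> /choice[g gP].
pose s := fix s k := if k is k'.+1 then g (s k').+1 else g 0%N.
exists s; split; last by case=> [|k]; exact: (gP _).2.
by apply: homo_ltn => [y x z|k]; [exact: ltn_trans|exact: (gP _).1].
Qed.

Lemma cvg_reindex (X : topologicalType) (u : nat -> X) (l : X)
    (g : nat -> nat) :
  (forall n, (n <= g n)%N) -> u @ \oo --> l -> u \o g @ \oo --> l.
Proof.
move=> g_ge ul; apply: (cvg_comp g u _ ul); apply/cvgnyPge => N.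
by exists N => // n /= Nn; exact: leq_trans (g_ge n).
Qed.

(** The product topology is the supremum of the topologies pulled back along
    the projections, so convergence may be tested on each of them. *)
Lemma prod_topology_cvg (I : Type) (K : I -> topologicalType) (T : Type)
    (F : set_system T) {FF : Filter F} (u : T -> prod_topology K)
    (l : prod_topology K) :
  (forall i, (fun t => u t i) @ F --> l i) -> u @ F --> l.
Proof.
move=> ul; apply/cvg_sup => i U [_ [[W oW <-] Wl WU]].
apply: (filterS WU); apply: (ul i W).
exact: open_nbhs_nbhs.
Qed.

(** The subsequences [s 0, s 1, ...] refine each other, and passing from [s k]
    to [s k.+1] makes coordinate [k] converge; the diagonal [n |-> s n n] is
    eventually a reindexing of each of them, so all coordinates converge along
    it. *)
Lemma sequentially_compact_prod (X : nat -> topologicalType) :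
  (forall i, sequentially_compact (X i)) ->
  sequentially_compact (prod_topology X).
Proof.
move=> X_sc u.
pose t i s := sval (cid (X_sc i (fun n => u (s n) i))).
have t_incr i s : {homo t i s : m n / (m < n)%N}.
  exact: (svalP (cid (X_sc i (fun n => u (s n) i)))).1.
have t_cvg i s : exists l : X i, (fun n => u (s (t i s n)) i) @ \oo --> l.
  exact: (svalP (cid (X_sc i (fun n => u (s n) i)))).2.
pose s := fix s k := if k is k'.+1 then s k' \o t k' (s k') else id.
have s_incr k : {homo s k : m n / (m < n)%N}.
  by elim: k => //= k IHk m n mn /=; apply/IHk/t_incr.
have s_tail k j n : exists m, (n <= m)%N /\ s (j + k)%N n = s k m.
  elim: j n => [|j IHj] n; first by exists n.
  rewrite addSn /=; have [m [nm ->]] := IHj (t (j + k)%N (s (j + k)%N) n).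
  exists m; split=> //; apply: leq_trans nm.
  exact/strictly_increasing_ge_id/t_incr.
exists (fun n => s n n); split.
  apply: homo_ltn => [y x z|k]; first exact: ltn_trans.
  exact/s_incr/strictly_increasing_ge_id/t_incr.
pose l : prod_topology X := fun i => sval (cid (t_cvg i (s i))).
have lP i : (fun n => u (s i.+1 n) i) @ \oo --> (l i : X i).
  exact: svalP (cid (t_cvg i (s i))).
exists l; apply: prod_topology_cvg => i.
(* From rank [i.+1] on, the diagonal runs through values of [s i.+1]. *)
have /choice[g gP] : forall n, exists m,
    (n <= m)%N /\ ((i < n)%N -> s n n = s i.+1 m).
  move=> n; have [m [nm sE]] := s_tail i.+1 (n - i.+1)%N n.
  by exists m; split=> // i_n; rewrite -sE subnK.
apply: cvg_trans (cvg_reindex _ _ _ g (fun n => (gP n).1) (lP i)).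
apply: near_eq_cvg; exists i.+1 => // n /= i_n.
by rewrite /= (gP n).2.
Qed.

(** A translation of the product is, in coordinate [i], a projection followed
    by a translation of the factor [X i]. *)
Lemma semitopological_semigroup_prod (I : eqType) (X : I -> topologicalType)
    (op : forall i, X i -> X i -> X i) :
  (forall i, semitopological_semigroup (op i)) ->
  @semitopological_semigroup (prod_topology X) (prod_mul op).
Proof.
move=> X_semi; split.
- by apply: hausdorff_product => i; have [] := X_semi i.
- by move=> x y w; apply: functional_extensionality_dep => i;
    have [_ opA _] := X_semi i; exact: opA.
have x_filter (x : prod_topology X) := @nbhs_filter (prod_topology X) x.
split=> c x; apply: prod_topology_cvg (x_filter x) _ _ _ => i;
  have [_ _ [op_l op_r]] := X_semi i.
  exact: (cvg_comp _ _ (@proj_continuous I X i x) (op_l (c i) (x i))).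
exact: (cvg_comp _ _ (@proj_continuous I X i x) (op_r (c i) (x i))).
Qed.

(** * Countable compactness *)

(** For an increasing cover a finite subcover amounts to a single member, the
    one of largest index. *)
Lemma finite_monotone_subcover (X : topologicalType) (V : nat -> set X) :
  countably_compact X -> (forall n, open (V n)) ->
  (forall m n, (m <= n)%N -> V m `<=` V n) ->
  \bigcup_n V n = [set: X] -> exists N, V N = [set: X].
Proof.
move=> X_cc V_open V_mono V_cover.
have [G [G_range /finite_seqP[r GE] G_cover]] :
    exists G : set (set X),
    [/\ G `<=` range V, finite_set G & \bigcup_(U in G) U = [set: X]].
  apply: X_cc; first exact: sub_countable (card_image_le _ _) (countableP _).
  - by move=> _ [n _ <-].
  - by rewrite bigcup_image.
have [N r_le] : exists N, forall U, U \in r -> U `<=` V N.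
  have : forall U, U \in r -> range V U.
    by move=> U Ur; apply: G_range; rewrite GE.
  elim: r {GE} => [|W r IHr] Vr; first by exists 0%N.
  have [n _ VnW] : range V W by apply: Vr; rewrite inE eqxx.
  have [N r_le] : exists N, forall U, U \in r -> U `<=` V N.
    by apply: IHr => U Ur; apply: Vr; rewrite inE Ur orbT.
  exists (maxn n N) => U; rewrite inE => /orP[/eqP->|/r_le UN].
    by rewrite -VnW; apply: V_mono; exact: leq_maxl.
  by apply: (subset_trans UN); apply: V_mono; exact: leq_maxr.
exists N; rewrite -subTset -G_cover GE => x [U /= Ur Ux].
exact: r_le Ux.
Qed.

(** * Multiplication in the extension *)

Section BrandtAlgebra.
Variables (L S : eqType) (mul : S -> S -> S) (z : S).

Lemma brandt0_elt_zero (a b : L) : brandt0_elt z a z b = None.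
Proof. by rewrite /brandt0_elt insubF ?eqxx. Qed.

Lemma brandt0_elt_neq0 (a b : L) (s : {s : S | s != z}) :
  brandt0_elt z a (val s) b = Some (a, s, b).
Proof. by rewrite /brandt0_elt valK. Qed.

(** Since [brandt0_elt] sends the zero of [S] to the zero of the extension, the
    product formula holds with no case distinction on whether the entries or
    their product vanish. *)
Lemma brandt0_mul_elt (a b c d : L) (s t : S) : is_zero mul z ->
  brandt0_mul mul z (brandt0_elt z a s b) (brandt0_elt z c t d) =
  if b == c then brandt0_elt z a (mul s t) d else None.
Proof.
move=> [mul0s muls0].
have [->|s_neq0] := eqVneq s z.
  by rewrite mul0s !brandt0_elt_zero if_same.
have [->|t_neq0] := eqVneq t z.
  by rewrite muls0 !brandt0_elt_zero if_same; case: brandt0_elt => [[[]]|].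
by rewrite (brandt0_elt_neq0 a b (Sub s s_neq0))
  (brandt0_elt_neq0 c d (Sub t t_neq0)).
Qed.

(** Two-sided multiplication by idempotents is the algebraic projection onto a
    block; it makes blocks visible to the topology, which knows only about
    translations. *)
Lemma brandt0_cut (one : S) (a b : L) (x : brandt0 L z) :
  is_zero mul z -> left_id one mul -> right_id one mul ->
  brandt0_mul mul z (brandt0_elt z a one a)
    (brandt0_mul mul z x (brandt0_elt z b one b)) =
  if x is Some (c, s, d) then
    if (c == a) && (d == b) then x else None
  else None.
Proof.
move=> z0 mul1s muls1; case: x => [[[c s] d]|].
  rewrite -brandt0_elt_neq0 brandt0_mul_elt // muls1.
  have [->|] := eqVneq d b; last first.
    by rewrite andbF; case: brandt0_elt => [[[]]|].
  by rewrite brandt0_mul_elt // mul1s andbT eq_sym; have [->|] := eqVneq c a.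
by case: (brandt0_elt _ _ _ _) => [[[? ?] ?]|].
Qed.

End BrandtAlgebra.

(** * Topology of one extension *)

Section BrandtTopology.
Variables (L : eqType) (S : topologicalType).
Variables (mul : S -> S -> S) (one z : S) (t : Topological (brandt0 L z)).
Hypothesis S_monoid : semitopological_monoid mul one.
Hypothesis S_zero : is_zero mul z.
Hypothesis B_ext : topological_brandt0_extension mul t.

Let B : topologicalType := brandt0_space t.
Let opB : B -> B -> B := brandt0_mul mul z.

(** The extension is only assumed to contain a copy of [S] in one diagonal
    block [(c, c)]; the identity
    [(a, s, b) = (a, 1, c) * ((c, s, c) * (c, 1, b))] transports continuity to
    all other blocks. *)
Lemma brandt0_elt_continuous (a b : L) :
  continuous (fun s : S => brandt0_elt z a s b : B).
Proof.
have [[_ _ [mulB_l mulB_r]] [c [_ elt_cont _]]] := B_ext.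
have [_ mul1s muls1] := S_monoid.
have -> : (fun s : S => brandt0_elt z a s b : B) =
    (opB (brandt0_elt z a one c)) \o
    ((opB^~ (brandt0_elt z c one b)) \o (fun s => brandt0_elt z c s c)).
  apply/funext => s /=; rewrite /opB.
  by rewrite !(brandt0_mul_elt, eqxx) // mul1s muls1.
move=> s; apply: continuous_comp; last exact: mulB_l.
by apply: continuous_comp; [exact: elt_cont|exact: mulB_r].
Qed.

(** A block without its zero is the set where the continuous projection of
    [brandt0_cut] is nonzero, and points of a Hausdorff space are closed. *)
Lemma brandt0_open_block (a b : L) :
  open [set x : B | exists s, x = Some (a, s, b)].
Proof.
have [[B_T2 _ [mulB_l mulB_r]] _] := B_ext.
have [_ mul1s muls1] := S_monoid.
pose cut (x : B) := opB (brandt0_elt z a one a)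
                      (opB x (brandt0_elt z b one b)).
have cut_cont : continuous cut.
  move=> x; apply: (continuous_comp (f := opB^~ _)); first exact: mulB_r.
  exact: mulB_l.
have -> : [set x : B | exists s, x = Some (a, s, b)] =
    cut @^-1` (~` [set None]).
  apply/seteqP; split=> x /=; rewrite /cut /opB brandt0_cut //.
    by move=> [s ->]; rewrite !eqxx.
  case: x => [[[c s] d]|] //; case: eqP => [->|_] //; case: eqP => [->|_] //.
  by exists s.
apply: open_comp => [x _|]; first exact: cut_cont.
apply/closed_openC/accessible_closed_set1.
exact: hausdorff_accessible.
Qed.

(** Given a neighbourhood [W] of the zero, let [V N] be the union of [W] and of
    the points near which no [x n] with [N <= n] lies.  The open nonzero blocks
    witness that the increasing sets [V N] cover the space, so some [V N] is
    everything; but a term [x n] with [N <= n] can only lie in [V N] through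
    [W]. *)
Lemma brandt0_cvg_zero (x : nat -> B) : countably_compact B ->
  (forall a b, exists N, forall n s, (N <= n)%N -> x n <> Some (a, s, b)) ->
  x @ \oo --> (None : B).
Proof.
move=> B_cc x_escapes U U_nbhs.
have : nbhs (None : B) U := U_nbhs.
rewrite nbhsE => -[W [W_open W0] WU].
pose V N : set B := W `|` interior [set y | forall n, (N <= n)%N -> x n <> y].
have [N VN] : exists N, V N = [set: B].
  apply: finite_monotone_subcover => // [N|m n mn|].
  - by apply: openU => //; exact: open_interior.
  - apply: setUS; apply: interiorS => y y_tail k nk.
    by apply: y_tail; exact: leq_trans nk.
  rewrite -subTset => -[[[a s] b]|] _; last by exists 0%N => //; left.
  have [N xN] := x_escapes a b.
  exists N => //; right; rewrite /interior nbhsE /=.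
  exists [set y : B | exists s, y = Some (a, s, b)].
    by split; [exact: brandt0_open_block|exists s].
  by move=> _ [r ->] n; exact: xN.
exists N => // n /= Nn; apply: WU.
have : V N (x n) by rewrite VN.
by case=> // /interior_subset /(_ n Nn).
Qed.

(** Either infinitely many terms share a nonzero block, where sequential
    compactness of [S] applies, or the whole sequence tends to the zero. *)
Lemma brandt0_sequentially_compact :
  sequentially_compact S -> countably_compact B -> sequentially_compact B.
Proof.
move=> S_sc B_cc x.
have [[a [b ab_often]]|x_escapes] := pselect (exists a b, forall N,
    exists n, (N <= n)%N /\ exists s, x n = Some (a, s, b)).
  have [s [s_incr /choice[y xy]]] := subsequence_infinitely_often _ ab_often.
  have [r [r_incr [l yl]]] := S_sc (fun k => val (y k)).
  exists (s \o r); split; first by move=> m n mn; exact/s_incr/r_incr.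
  exists (brandt0_elt z a l b : B).
  have -> : x \o (s \o r) =
      (fun u : S => brandt0_elt z a u b : B) \o ((fun k => val (y k)) \o r).
    by apply/funext => k /=; rewrite xy brandt0_elt_neq0.
  exact: (cvg_comp _ _ yl (brandt0_elt_continuous a b l)).
exists id; split=> //; exists (None : B); apply: brandt0_cvg_zero => // a b.
apply: contrapT => ab_often; apply: x_escapes; exists a, b => N.
apply: contrapT => xN; apply: ab_often; exists N => n s Nn xs.
by apply: xN; exists n; split=> //; exists s.
Qed.

End BrandtTopology.

Theorem theorem2p3
    (L : nat -> eqType) (S : nat -> topologicalType)
    (mul : forall i, S i -> S i -> S i) (one zero : forall i, S i)
    (tB : forall i, Topological (brandt0 (L i) (zero i)))
    (L_ge1 : forall i, [set: L i] !=set0)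
    (S_monoid : forall i, semitopological_monoid (mul i) (one i))
    (S_zero : forall i, is_zero (mul i) (zero i))
    (S_seq_compact : forall i, sequentially_compact (S i))
    (B_ext : forall i, topological_brandt0_extension (mul i) (tB i))
    (B_countably_compact : forall i, countably_compact (brandt0_space (tB i))) :
  let P : topologicalType := prod_topology (fun i => brandt0_space (tB i)) in
  [/\ hausdorff_space P, sequentially_compact P
    & @semitopological_semigroup P
        (prod_mul (fun i => brandt0_mul (mul i) (zero i)))].
Proof.
move=> P.
have P_semi : @semitopological_semigroup P
    (prod_mul (fun i => brandt0_mul (mul i) (zero i))).
  by apply: semitopological_semigroup_prod => i; have [] := B_ext i.
split=> //; first by have [] := P_semi.
apply: sequentially_compact_prod => i.
exact: (brandt0_sequentially_compact _ _ _ (one i)) (S_monoid i) (S_zero i)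
  (B_ext i) _ _.
Qed.
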